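(* Let $n=\prod_p p^{v_p}$ be a positive integer such that (i) $v_p\le 2$ for all primes $p\mid n$; (ii) $p\nmid (q^{v_q}-1)$ for all primes $p,q$ dividing $n$; (iii) $4\nmid n$. Then a cyclic Galois field extension of degree $n$ admits exactly $n/r(n)$ Hopf-Galois structures, all of which are of cyclic type, where $r(n)=\prod_{p\mid n}p$.
   Context: Hopf-Galois structures on a Galois extension $L/K$ with group $\Gamma$ correspond (Greither–Pareigis) to regular subgroups $G$ of $\mathrm{Perm}(\Gamma)$ normalized by the left regular representation $\lambda(\Gamma)$; the type of the structure is the isomorphism class of $G$. Equivalently, the number of structures of type $G$ is the number of $\mathrm{Aut}(G)$-conjugacy classes of injective homomorphisms $\Gamma\to\mathrm{Hol}(G)=\rho(G)\cdot\mathrm{Aut}(G)$ with regular image. *)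

(* Defs.v *)
From mathcomp Require Import all_boot all_fingroup all_solvable.
Set Implicit Arguments. Unset Strict Implicit. Unset Printing Implicit Defensive.
Local Open Scope group_scope.

Definition lambda_perm (gT : finGroupType) (g : gT) : {perm gT} :=
  perm (mulgI g).

Definition lambda_img (gT : finGroupType) : {set {perm gT}} :=
  [set lambda_perm g | g : gT].

Definition regular_perm (gT : finGroupType) (G : {set {perm gT}}) : bool :=
  [transitive G, on [set: gT] | 'P] && [forall x : gT, 'C_G[x | 'P] == 1].

(* Regular subgroups of Perm(Gamma) normalized by lambda(Gamma); by
   Greither--Pareigis these are in bijection with the Hopf-Galois structures
   on a Galois extension with group Gamma. *)
Definition HGS (gT : finGroupType) : {set {group {perm gT}}} :=
  [set G : {group {perm gT}} | regular_perm G && (lambda_img gT \subset 'N(G))].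

Definition rad (n : nat) : nat := \prod_(p <- primes n) p.

(* Main.v *)
Require Import Defs.
From mathcomp Require Import all_boot all_fingroup all_solvable.
From mathcomp Require Import ssralg finalg ring.

(* Under (i) and (ii) every Sylow subgroup S of a group G of order n is abelian
   and central in its normaliser, so the transfer G -> S shows that S meets G'
   trivially; hence G is abelian. If G is moreover a regular subgroup normalised
   by the regular cyclic group generated by s, an elementary abelian Sylow
   subgroup of order p^2 would force the p-part of s to have order p (p is odd
   by (iii)); so G is cyclic.

   For the count, let h in G agree with s at the base point, and write
   s h s^-1 = h^k. In the coordinate h^i |-> i the permutation s is the affine
   map i |-> k i + 1, so G is determined by k; transitivity of s forces k = 1
   modulo every prime dividing n, which leaves n / rad n residues. Conversely
   the affine maps x |-> a x + 1 of Z/n with a = 1 modulo rad n generate that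
   many distinct regular subgroups normalised by translations. *)

Set Implicit Arguments.
Unset Strict Implicit.
Unset Printing Implicit Defensive.

(** * Fixed points of p-groups, fusion and transfer *)

Section Transfer.

Local Open Scope group_scope.

Variables (gT : finGroupType) (p : nat).
Implicit Types (A G P Q S : {group gT}).

(** The fixed points of [A] on [Q] form a subgroup of order [q ^ j], and [p] divides
    [q ^ i - q ^ j]; this forces [j = i]. The case [q = p] is allowed. *)
Lemma pgroup_cent_card A Q (q i : nat) :
    prime q -> p.-group A -> A \subset 'N(Q) -> #|Q| = (q ^ i)%N ->
    (forall j, (j < i)%N -> ~~ (p %| q ^ i - q ^ j)) ->
  A \subset 'C(Q).
Proof.
move=> q_pr pA nQA cardQ ndiv.
have sCQ : 'C_Q(A) \subset Q by exact: subsetIl.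
have /(dvdn_pfactor _ _ q_pr)[j le_ji cardC] : #|'C_Q(A)| %| q ^ i.
  by rewrite -cardQ cardSg.
have := @pgroup_fix_mod _ _ _ 'J%act p A Q pA; rewrite astabsJ => /(_ nQA)/eqP.
rewrite afixJ eqn_mod_dvd ?subset_leq_card // cardQ cardC.
move: le_ji; rewrite leq_eqVlt => /predU1P[eq_ji _ | /ndiv/negP //].
rewrite centsC; apply/setIidPl/eqP.
by rewrite eqEcard sCQ cardQ cardC eq_ji /=.
Qed.

(* Burnside's fusion lemma: elements of an abelian Sylow subgroup that are
   conjugate in G are already conjugate in its normaliser. *)
Lemma abelian_Sylow_fusion G S y u :
    p.-Sylow(G) S -> abelian S -> 'N_G(S) \subset 'C(S) ->
    u \in G -> y \in S -> y ^ u \in S ->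
  y ^ u = y.
Proof.
move=> sylS abS nSC Gu Sy Syu.
have sSG := pHall_sub sylS.
have Gy := subsetP sSG y Sy.
have sSC : S \subset 'C_G[y].
  rewrite subsetI sSG; apply/subsetP => z Sz.
  by apply/cent1P; apply: (centsP abS).
have sSuC : S :^ u^-1 \subset 'C_G[y].
  rewrite subsetI; apply/andP; split.
    by rewrite -(conjSg _ _ u) conjsgKV (conjGid Gu).
  rewrite -(conjSg _ _ u) conjsgKV -normJ conjg_set1; apply/subsetP => z Sz.
  by apply/cent1P; apply: (centsP abS).
have sylSu : p.-Sylow(G) (S :^ u^-1)%G by rewrite pHallJ ?groupV.
(* [S] and its conjugate under [u^-1] are both Sylow in the centraliser of [y], so some [c] fixing
   [y] carries one to the other; then [c * u] normalises [S]. *)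
have [c] := Sylow_trans (pHall_subl sSC (subsetIl _ _) sylS)
              (pHall_subl sSuC (subsetIl _ _) sylSu).
case/setIP=> Gc cyc defSu.
have defS : S :^ (c * u) = S.
  by rewrite conjsgM -defSu /= conjsgKV.
have /(subsetP nSC) cScu : c * u \in 'N_G(S).
  by rewrite inE groupM //=; apply/normP.
have ycu : y ^ (c * u) = y by rewrite /conjg -(centP cScu) // mulKg.
have yc : y ^ c = y by rewrite /conjg -(cent1P cyc) mulKg.
by rewrite -[in RHS]ycu conjgM yc.
Qed.

(** The transfer into the abelian group [S] kills the derived subgroup, while on [S] it is the power
    map of exponent [#|G : S|], which is prime to [p]. *)
Lemma abelian_Sylow_der1_TI G S :
    prime p -> p.-Sylow(G) S -> abelian S -> 'N_G(S) \subset 'C(S) ->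
  S :&: G^`(1) = 1.
Proof.
move=> p_pr sylS abS nSC.
have sSG := pHall_sub sylS.
have abA : abelian (idm S @* S) by rewrite morphim_idm.
pose V := transfer G abA.
have V1 x : x \in G^`(1) -> V x = 0%R.
  have abV : abelian (transfer_morphism G abA @* G).
    by apply/centsP => a _ b _; exact: GRing.addrC.
  rewrite -[V x]/(transfer_morphism G abA x) => Gx.
  apply/set1gP; rewrite -[[1]](derG1P abV) -morphim_der //.
  exact: mem_morphim (subsetP (der_sub 1 G) x Gx) Gx.
apply/trivgP/subsetP=> g /setIP[Sg /V1 Vg0].
have Gg := subsetP sSG g Sg.
have trX := transversalP (rcosets_cycle_partition sSG Gg).
set X := transversal _ _ in trX.
have := transfer_cycle_expansion sSG abA Gg trX.
rewrite -/V Vg0.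
(* Fusion removes the conjugation from each summand; the remaining exponents are the lengths of the
   [<[g]>]-orbits on cosets, with sum [#|G : S|]. *)
rewrite (eq_bigr (fun x => FiniteModule.fmod abA g *+ #|<[g]> : S :* x|)%R).
  rewrite GRing.sumrMnr (sum_index_rcosets_cycle sSG Gg trX).
  move=> /(congr1 val); rewrite FiniteModule.fmvalZ FiniteModule.fmodK.
    rewrite FiniteModule.fmval0 => /esym/eqP; rewrite -order_dvdn => dvd_g.
    have: #[g] %| gcdn #|S| #|G : S| by rewrite dvdn_gcd dvd_g order_dvdG.
    have [_ pS p'i] := and3P sylS.
    by rewrite (eqP (pnat_coprime pS p'i)) dvdn1 order_eq1 inE.
  by rewrite /= morphim_idm.
move=> x Xx; have Gx := subsetP (transversal_sub trX) x Xx.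
have Sgx : (g ^+ #|<[g]> : S :* x|) ^ x^-1 \in S.
  have := mulg_exp_card_rcosets S g x; rewrite mem_rcoset.
  by rewrite conjgE invgK mulgA.
rewrite /restrm /= /idm (abelian_Sylow_fusion sylS abS nSC) ?groupV ?groupX //.
by rewrite FiniteModule.fmodX /= ?morphim_idm.
Qed.

End Transfer.

(** * Groups of order [n]: commutativity, then cyclicity in the regular setting *)

Section AbelianOrder.

Local Open Scope group_scope.

Variable (n : nat).
Hypothesis logn_le2 : forall p : nat, p \in primes n -> (logn p n <= 2)%N.
Hypothesis ndvd_pq : forall p q : nat, p \in primes n -> q \in primes n ->
  ~~ (p %| q ^ logn q n - 1)%N.

(** After the factor [q ^ j] is removed, either [j = 0], or the exponent is 2 and [q - 1] divides
    [q ^ 2 - 1]; both cases reduce to [ndvd_pq]. *)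
Lemma ndvd_pow_sub (p q j : nat) :
    p \in primes n -> q \in primes n -> p != q -> (j < logn q n)%N ->
  ~~ (p %| q ^ logn q n - q ^ j).
Proof.
move=> pn qn neq_pq ltj; have lev := logn_le2 qn.
have := ndvd_pq pn qn.
move: pn qn; rewrite !mem_primes => /andP[p_pr _] /andP[q_pr _].
have -> : (q ^ logn q n - q ^ j = q ^ j * (q ^ (logn q n - j) - 1))%N.
  by rewrite mulnBr muln1 -expnD subnKC // ltnW.
rewrite Euclid_dvdM // negb_or Euclid_dvdX // (dvdn_prime2 p_pr q_pr) (negPf neq_pq).
rewrite /=; apply: contra => dvdp.
have [j0|j_gt0] := posnP j; first by move: dvdp; rewrite j0 subn0.
have -> : logn q n = 2 by apply/eqP; rewrite eqn_leq lev (leq_ltn_trans j_gt0).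
have e1 : (logn q n - j = 1)%N.
  by apply/eqP; rewrite eqn_leq subn_gt0 ltj leq_subLR (leq_trans lev) // addn1 ltnS.
move: dvdp; rewrite e1 expn1 => dvdp.
by rewrite -(exp1n 2) subn_sqr dvdn_mulr.
Qed.

Lemma abelian_of_order (gT : finGroupType) (G : {group gT}) :
  #|G| = n -> abelian G.
Proof.
move=> oG; apply/derG1P/eqP; apply: contraT; rewrite trivg_card1 => nt.
have [|p p_pr dvdp] := @pdivP #|G^`(1)|; first by rewrite ltn_neqAle eq_sym nt cardG_gt0.
have [R sylR] := Sylow_exists p G^`(1).
have sRG : R \subset G := subset_trans (pHall_sub sylR) (der_sub 1 G).
have [S sylS sRS] := Sylow_superset sRG (pHall_pgroup sylR).
have pn : p \in primes n.
  by rewrite mem_primes p_pr -oG cardG_gt0 (dvdn_trans dvdp) ?cardSg ?der_sub.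
have oS : #|S| = (p ^ logn p n)%N by rewrite (card_Hall sylS) p_part oG.
have abS : abelian S.
  by apply: (p2group_abelian (pHall_pgroup sylS)); rewrite oS pfactorK ?logn_le2.
have nSC : 'N_G(S) \subset 'C(S).
  (* The normaliser is generated by its Sylow subgroups: the one for [p] lies in the abelian [S],
     the others centralise [S] by the fixed-point count. *)
  rewrite -{1}(Sylow_gen 'N_G(S)) gen_subG; apply/bigcupsP => Q /SylowP[q q_pr sylQ].
  have [sQG nSQ] := subsetIP (pHall_sub sylQ).
  have [eqpq|neq_qp] := eqVneq q p.
    have pQ : p.-group Q by rewrite -eqpq (pHall_pgroup sylQ).
    rewrite centsC (centsS _ abS) //.
    have sSN : S \subset 'N_G(S) by rewrite subsetI normG (pHall_sub sylS).
    rewrite (sub_normal_Hall (pHall_subl sSN (subsetIl _ _) sylS)) //.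
      by rewrite /normal sSN subsetIr.
    by rewrite subsetI sQG.
  have [->|ntQ] := eqsVneq Q 1; first exact: sub1G.
  have [_ q_dvd _] := pgroup_pdiv (pHall_pgroup sylQ) ntQ.
  have qn : q \in primes n.
    by rewrite mem_primes q_pr -oG cardG_gt0 (dvdn_trans q_dvd) ?cardSg.
  apply: (pgroup_cent_card p_pr (pHall_pgroup sylQ) nSQ oS) => j.
  exact: ndvd_pow_sub.
have TI := abelian_Sylow_der1_TI p_pr sylS abS nSC.
have: R :=: 1 by apply/trivgP; rewrite -TI subsetI sRS (pHall_sub sylR).
move/(congr1 (fun A : {set _} => #|A|)); rewrite /= cards1 (card_Hall sylR).
by move/eqP; rewrite p_part_eq1 mem_primes p_pr cardG_gt0 dvdp.
Qed.

(** In an abelian group the Sylow subgroup is the [p]-core, hence characteristic. *)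
Lemma Sylow_abelian_norm (gT : finGroupType) (p : nat) (A : {set gT})
    (G P : {group gT}) :
  abelian G -> p.-Sylow(G) P -> A \subset 'N(G) -> A \subset 'N(P).
Proof.
move=> abG sylP; apply: char_norm_trans.
rewrite -(normal_Hall_pcore sylP) ?pcore_char //.
by rewrite -sub_abelian_normal ?(pHall_sub sylP).
Qed.

Lemma conjg_expg_comm (gT : finGroupType) (u t : gT) i :
  commute t [~ u, t] -> u ^ (t ^+ i) = u * [~ u, t] ^+ i.
Proof.
move=> ctz; elim: i => [|i IHi]; first by rewrite conjg1 mulg1.
rewrite expgSr conjgM IHi conjMg conjg_mulR -mulgA; congr (_ * _).
by rewrite expgS conjXg /conjg -ctz mulKg.
Qed.

Hypothesis ndvd4 : ~~ (4 %| n).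

(* Write t for the p-part of s and t x0 = (u v) x0 with u in P and v in the
   p'-part of G, which t centralises. If P were elementary abelian of order
   p^2, then t would act on it by a unipotent map, so the "norm"
   u u^t ... u^(t^(p-1)) would vanish for odd p, and t^p would fix x0. *)
Lemma cyclic_of_cyclic_semireg_norm (T : finType) (G : {group {perm T}})
    (s : {perm T}) (x0 : T) :
    #|G| = n -> #[s] = n -> s \in 'N(G) ->
    (forall y, exists2 g : {perm T}, g \in G & g x0 = y) ->
    (forall g : {perm T}, g \in G -> g x0 = x0 -> g = 1) ->
    (forall i, (s ^+ i) x0 = x0 -> s ^+ i = 1) ->
  cyclic G.
Proof.
move=> oG os nGs Gtr Gfree sfree; have abG := abelian_of_order oG.
have n_gt0 : (0 < n)%N by rewrite -oG cardG_gt0.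
apply: nil_Zgroup_cyclic (abelian_nil abG).
apply/forall_inP => P /SylowP[p p_pr sylP].
have oP : #|P| = (p ^ logn p n)%N by rewrite (card_Hall sylP) p_part oG.
have sPG := pHall_sub sylP.
have pP := pHall_pgroup sylP.
have [lt1|] := boolP (logn p n <= 1)%N.
  case: (logn p n) lt1 oP => [|[|//]] _ oP.
    by rewrite (card1_trivg oP) cyclic1.
  by apply: prime_cyclic; rewrite oP expn1.
rewrite -ltnNge => gt1; have pn : p \in primes n.
  by rewrite -logn_gt0 (ltnW gt1).
have eq2 : logn p n = 2 by apply/eqP; rewrite eqn_leq gt1 logn_le2.
rewrite eq2 in oP; have dvd_p2 : p ^ 2 %| n by rewrite pfactor_dvdn ?eq2.
have p_gt2 : (2 < p)%N.
  rewrite ltn_neqAle prime_gt1 // andbT; apply: contraNneq ndvd4 => p2.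
  by rewrite -p2 in dvd_p2.
apply: contraT => ncycP.
have expP u : u \in P -> u ^+ p = 1.
  move=> Pu; apply/eqP; rewrite -order_dvdn.
  have: #[u] %| p ^ 2 by rewrite -oP order_dvdG.
  case/(dvdn_pfactor _ _ p_pr) => j; case: j => [|[|[|//]]] _ ou.
  - by rewrite ou dvd1n.
  - by rewrite ou dvdnn.
  case/negP: ncycP; apply/cyclicP; exists u; apply/eqP.
  by rewrite eq_sym eqEcard cycle_subG Pu oP -ou /=.
pose t := s ^+ (n %/ p ^ 2).
have tp2 : t ^+ (p ^ 2) = 1 by rewrite -expgM divnK // -os expg_order.
have tp : t ^+ p != 1.
  have nE := divnK dvd_p2.
  have m_gt0 : (0 < n %/ p ^ 2)%N by move: n_gt0; rewrite -{1}nE muln_gt0 => /andP[].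
  rewrite -expgM -order_dvdn os -[X in (X %| _)%N]nE dvdn_pmul2l //.
  by have := dvdn_Pexp2l 2 1 (prime_gt1 p_pr); rewrite expn1 => ->.
have pt : p.-group <[t]>.
  apply: (@pnat_dvd _ (p ^ 2)); first by rewrite -orderE order_dvdn tp2.
  by rewrite pnatX pnat_id.
have nGt : <[t]> \subset 'N(G) by rewrite cycle_subG groupX.
have nPt := Sylow_abelian_norm abG sylP nGt.
pose D := 'O_p^'(G)%G; have hallD := nilpotent_pcore_Hall p^' (abelian_nil abG).
(* The [p]-group [<[t]>] acts trivially on each Sylow subgroup of [D], by the fixed-point count. *)
have cDt : <[t]> \subset 'C(D).
  rewrite centsC -(Sylow_gen D) gen_subG; apply/bigcupsP => Q /SylowP[q q_pr sylQ].
  rewrite centsC; have [->|ntQ] := eqsVneq Q 1; first exact: cents1.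
  have [_ q_dvd _] := pgroup_pdiv (pHall_pgroup sylQ) ntQ.
  have p'q : q \in p^'.
    have := pcore_pgroup p^' G; rewrite -/D => /pgroupP; apply=> //.
    by rewrite (dvdn_trans q_dvd) // cardSg // (pHall_sub sylQ).
  have sylQG := subHall_Sylow hallD p'q sylQ.
  have qn : q \in primes n.
    rewrite mem_primes q_pr -oG cardG_gt0 (dvdn_trans q_dvd) //.
    by rewrite cardSg // (pHall_sub sylQG).
  have nQt := Sylow_abelian_norm abG sylQG nGt.
  apply: (@pgroup_cent_card _ p _ _ q (logn q n) q_pr pt nQt).
    by rewrite (card_Hall sylQG) p_part oG.
  by move=> j; apply: ndvd_pow_sub; rewrite // eq_sym.
have [g Gg gx0] := Gtr (t x0).
pose u := g.`_p; pose v := g.`_p^'.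
have guv : u * v = g := consttC p g.
have Gu : u \in G by rewrite groupX.
have Gv : v \in G by rewrite groupX.
have Pu : u \in P.
  by rewrite (mem_normal_Hall sylP) ?p_elt_constt // -sub_abelian_normal.
have Dv : v \in D.
  by rewrite (mem_normal_Hall hallD) ?p_elt_constt // pcore_normal.
have ctv : commute t v by apply: (centsP cDt); rewrite ?cycle_id.
pose W := [~: P, <[t]>]%G; pose z := [~ u, t].
have Wz : z \in W by rewrite mem_commg ?cycle_id.
have sWP : W \subset P by rewrite commg_subl.
(* [P <*> <[t]>] is a [p]-group, hence nilpotent, so the commutator shrinks [P]. Thus [W] has order
   at most [p] and [t] centralises it. *)
have prW : W \proper P.
  apply: (@nil_comm_properl _ (P <*> <[t]>)%G).
  - by apply: (@pgroup_nil _ p); rewrite /= norm_joinEr // pgroupM pP.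
  - exact: joing_subl.
  - by apply: contraNneq ncycP => ->; exact: cyclic1.
  - by rewrite subsetI joing_subr.
have ctz : commute t z.
  have: #|W| %| p ^ 2 by rewrite -oP cardSg.
  case/(dvdn_pfactor _ _ p_pr) => j le_j oW.
  have cWt : <[t]> \subset 'C(W).
    apply: (pgroup_cent_card p_pr pt _ oW); first exact: commg_normr.
    have lt_j : (j <= 1)%N.
      by move: (proper_card prW); rewrite oW oP ltn_exp2l ?prime_gt1.
    case: j lt_j {le_j oW} => [|[|//]] _ [|//] // _.
    rewrite expn1 expn0; apply/negP => /dvdn_leq.
    by rewrite subn_gt0 (prime_gt1 p_pr) leqNgt ltn_subrL (prime_gt0 p_pr) => /(_ isT).
  by apply: (centsP cWt); rewrite ?cycle_id.
have Pz : z \in P := subsetP sWP z Wz.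
have Gz : z \in G := subsetP sPG z Pz.
(* The conjugate of [g] by [t ^+ i] is [u * z ^+ i * v]; the exponents of [z] for [i < m] add up to
   ['C(m, 2)]. *)
have tm m : (t ^+ m) x0 = (u ^+ m * z ^+ 'C(m, 2) * v ^+ m) x0.
  elim: m => [|m IHm]; first by rewrite bin0n !expg0 !mulg1.
  have -> : u ^+ m.+1 * z ^+ 'C(m.+1, 2) * v ^+ m.+1 =
            (u ^+ m * z ^+ 'C(m, 2) * v ^+ m) * (u * z ^+ m * v).
    rewrite binS bin1 expgD !expgSr.
    have cG a b : a \in G -> b \in G -> a * b = b * a.
      by move=> Ga Gb; apply: (centsP abG).
    rewrite -!mulgA; congr (_ * _).
    rewrite (mulgA (v ^+ m) u) (cG (v ^+ m) u) ?groupX // -(mulgA u).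
    rewrite (mulgA (z ^+ _) u) (cG (z ^+ _) u) ?groupX // -!mulgA.
    by congr (_ * (_ * _)); rewrite !mulgA (cG (v ^+ m) (z ^+ m)) ?groupX.
  have <- : g ^ (t ^+ m) = u * z ^+ m * v.
    rewrite -guv conjMg conjg_expg_comm //; congr (_ * _).
    by rewrite /conjg (commuteX _ (commute_sym ctv)) mulKg.
  by rewrite permM -IHm -permM -conjgC permM gx0 -permM -expgS.
have tpx0 : (t ^+ p) x0 = (v ^+ p) x0.
  (* As [p] is odd, it divides ['C(p, 2)], so both the [u] and [z] factors vanish. *)
  rewrite tm expP // mul1g; have /dvdnP[k ->] : p %| 'C(p, 2).
    by rewrite prime_dvd_bin.
  by rewrite mulnC expgM expP // expg1n mul1g.
have fix_w : (t ^+ p * v ^- p) x0 = x0 by rewrite permM tpx0 permK.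
have cw : commute (t ^+ p) (v ^- p).
  by apply/commuteV/commuteX/commute_sym/commuteX/commute_sym.
(* The [p]-th power of [t ^+ p * v ^- p] is a power of [v] fixing [x0], so [v ^+ (p ^ 2) = 1],
   whereas [v] has order prime to [p]. *)
have v1 : v = 1.
  have: ((t ^+ p * v ^- p) ^+ p) x0 = x0 by exact: permX_fix.
  rewrite expgMn // -expgM mulnn tp2 mul1g expVgn -expgM mulnn.
  move/(Gfree _ _) => /(_ (groupVr (groupX _ Gv)))/eqP.
  rewrite invg_eq1 -order_dvdn => dvdv.
  have p'v : p^'.-elt v := p_elt_constt _ _.
  apply/eqP; rewrite -order_eq1 -dvdn1 -(eqP (_ : coprime (p ^ 2) #[v])).
    by rewrite dvdn_gcd dvdv dvdnn.
  by apply: (@pnat_coprime p); rewrite ?pnatX ?pnat_id.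
rewrite v1 expg1n perm1 -expgM in tpx0.
by case/eqP: tp; rewrite -expgM (sfree _ tpx0).
Qed.

End AbelianOrder.

(** * Divisibility properties of the radical *)

Section Radical.

Lemma prod_primes_dvd (s : seq nat) (m : nat) :
  uniq s -> all prime s -> (forall p, p \in s -> p %| m) ->
  \prod_(p <- s) p %| m.
Proof.
elim: s => [|q s IHs] /=; first by rewrite big_nil dvd1n.
case/andP=> q_s uniq_s /andP[q_pr pr_s] dvd_m; rewrite big_cons Gauss_dvd.
  rewrite dvd_m ?mem_head // IHs // => p p_s.
  by rewrite dvd_m // inE p_s orbT.
rewrite prime_coprime // Euclid_dvd_prod // big_has.
apply/hasPn => p p_s; rewrite (dvdn_prime2 q_pr (allP pr_s p p_s)).
by apply: contraNneq q_s => ->.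
Qed.

Lemma rad_dvd (n m : nat) : (forall p, p \in primes n -> p %| m) -> rad n %| m.
Proof. by apply: prod_primes_dvd; rewrite ?primes_uniq ?all_prime_primes. Qed.

Lemma rad_dvdn (n : nat) : rad n %| n.
Proof. by apply: rad_dvd => p; rewrite mem_primes => /and3P[]. Qed.

Lemma dvdn_rad (n p : nat) : p \in primes n -> p %| rad n.
Proof. by move=> p_n; rewrite /rad (big_rem p) //= dvdn_mulr. Qed.

Lemma dvdn_rad_sqr (n : nat) :
  0 < n -> (forall p, p \in primes n -> logn p n <= 2) -> n %| rad n ^ 2.
Proof.
move=> n_gt0 le2; apply/dvdn_partP => // p p_n; rewrite p_part.
by rewrite (dvdn_trans (dvdn_exp2l p (le2 p p_n))) // dvdn_exp2r ?dvdn_rad.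
Qed.

(** If [n] is even, an odd prime [q] dividing it would make [q ^ logn q n - 1] even, against (ii)
    with [p = 2]; so [n] is a power of 2, and (iii) leaves [n = 2]. *)
Lemma odd_or_eq_rad (n : nat) :
    0 < n -> ~~ (4 %| n) ->
    (forall p q, p \in primes n -> q \in primes n ->
      ~~ (p %| q ^ logn q n - 1)) ->
  odd n \/ rad n = n.
Proof.
move=> n_gt0 n4 ndvd; have [|even_n] := boolP (odd n); [by left | right].
have two_n : 2 \in primes n by rewrite mem_primes n_gt0 dvdn2 even_n.
have n2 : 2.-nat n.
  apply/pnatP => // q q_pr q_n; rewrite inE /=.
  have q_in : q \in primes n by rewrite mem_primes q_pr n_gt0.
  case: (even_prime q_pr) => [->//|odd_q]; have := ndvd _ _ two_n q_in.
  by rewrite dvdn2 oddB ?expn_gt0 ?prime_gt0 // oddX odd_q orbT.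
have log1 : logn 2 n = 1.
  apply/eqP; rewrite eqn_leq logn_gt0 two_n andbT leqNgt.
  by apply: contra n4 => lt1; rewrite -[4]/(2 ^ 2) pfactor_dvdn.
have -> : n = 2 by rewrite -(part_pnat_id n2) p_part log1.
by rewrite /rad big_seq1.
Qed.

End Radical.

(** * Geometric sums modulo [n] *)

Section GeometricSum.

(** The [j]-th iterate at 0 of the affine map sending [x] to [k * x + 1]. *)
Definition geom (k j : nat) := \sum_(i < j) k ^ i.

Lemma geomS k j : geom k j.+1 = k * geom k j + 1.
Proof.
rewrite /geom big_ord_recl expn0 addnC big_distrr /=; congr (_ + _).
by apply: eq_bigr => i _; rewrite expnS.
Qed.

Lemma geomSr k j : geom k j.+1 = geom k j + k ^ j.
Proof. by rewrite /geom big_ord_recr. Qed.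

Lemma geom_surj_dvd (p k : nat) :
    prime p -> ~~ (p %| k) ->
    (forall i, exists j, geom k j = i %[mod p]) ->
  p %| k - 1.
Proof.
move=> p_pr ndvd_k surj; apply: contraT => ndvd.
have k_gt0 : 0 < k by case: k ndvd_k {surj ndvd} => //; rewrite dvdn0.
(* Modulo [p], [i] is [-1 / (k - 1)], the fixed point of the affine map. Reaching it from 0 would
   make [k ^ j = 1 + geom k j * (k - 1)] divisible by [p]. *)
have [i _] := Bezoutl (k - 1) (prime_gt0 p_pr).
have /eqP-> : coprime p (k - 1) by rewrite prime_coprime.
have [j eq_ij] := surj i; rewrite /dvdn -modnDmr -modnMml -eq_ij modnMml modnDmr.
have -> : 1 + geom k j * (k - 1) = k ^ j.
  apply: (@addIn (geom k j)); rewrite [RHS]addnC -geomSr geomS addnC addnCA.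
  by rewrite -mulnS subn1 prednK // mulnC addnC.
by rewrite -/(dvdn p (k ^ j)) Euclid_dvdX // (negPf ndvd_k).
Qed.

Variables (n d : nat).
Hypothesis dvd_d2 : n %| d ^ 2.

Lemma modnDdvd x y : n %| y -> x + y = x %[mod n].
Proof. by move=> /eqP y0; rewrite -modnDmr y0 addn0. Qed.

(** Only the constant and linear binomial terms survive, because [n] divides [d ^ 2]. *)
Lemma expn_1D i : (1 + d) ^ i = 1 + i * d %[mod n].
Proof.
elim: i => [|i IHi]; first by rewrite expn0 mul0n addn0.
rewrite expnS -modnMmr IHi modnMmr.
have -> : (1 + d) * (1 + i * d) = 1 + i.+1 * d + i * d ^ 2 by ring.
by rewrite modnDdvd // dvdn_mull.
Qed.

Lemma geom_1D m : geom (1 + d) m = m + 'C(m, 2) * d %[mod n].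
Proof.
elim: m => [|m IHm]; first by rewrite /geom big_ord0 bin0n mul0n.
rewrite geomSr -modnDm IHm expn_1D modnDm; congr (_ %% _).
by rewrite binS bin1; ring.
Qed.

Hypothesis odd_or_0 : odd n \/ d = 0.
Hypothesis rad_d : rad n %| d.
Hypothesis n_gt0 : 0 < n.

Lemma double_geom_1D m : 2 * (m + 'C(m, 2) * d) = m * (2 + m.-1 * d).
Proof.
by rewrite mulnDr mulnA -mul_bin_diag bin1 mulnDr mulnA (mulnC 2).
Qed.

Lemma coprime_2D m : odd n -> coprime n (2 + m * d).
Proof.
move=> odd_n; rewrite coprime_has_primes ?addn_gt0 //; apply/hasPn => p.
rewrite !mem_primes => /and3P[p_pr _ p_2d]; apply/negP => /and3P[_ _ p_n].
have p_d : p %| m * d.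
  rewrite dvdn_mull // (dvdn_trans _ rad_d) // dvdn_rad //.
  by rewrite mem_primes p_pr n_gt0.
move: p_2d; rewrite (dvdn_addl _ p_d) dvdn_prime2 // => /eqP p2.
by move: p_n; rewrite p2 dvdn2 odd_n.
Qed.

(** For odd [n], twice the sum is [m * (2 + m.-1 * d)] modulo [n], and both 2 and the second factor
    are prime to [n]. For [d = 0] the sum is [m] itself. *)
Lemma dvdn_geom_1D m : (n %| geom (1 + d) m) = (n %| m).
Proof.
rewrite /dvdn geom_1D -!/(dvdn _ _).
case: odd_or_0 => [odd_n | ->]; last by rewrite muln0 addn0.
rewrite -(Gauss_dvdr (m := n) _ (_ : coprime n 2)) ?coprimen2 //.
by rewrite double_geom_1D Gauss_dvdl // coprime_2D.
Qed.

(** Twice the binomial term is [(1 + d) * d ^ 2], a multiple of [n]; 2 cancels when [n] is odd. With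
    [expn_1D_self] this yields the conjugation rule [affine_conj]. *)
Lemma geom_1D_self : geom (1 + d) (1 + d) = 1 + d %[mod n].
Proof.
rewrite geom_1D; case: odd_or_0 => [odd_n | ->]; last by rewrite muln0 addn0.
rewrite modnDdvd // -(@Gauss_dvdr _ 2) ?coprimen2 // mulnA -mul_bin_diag bin1 /=.
by rewrite -mulnA dvdn_mull // mulnn.
Qed.

Lemma expn_1D_self : (1 + d) ^ (1 + d) = 1 + d %[mod n].
Proof.
rewrite expn_1D mulnDl mul1n mulnn addnA.
by rewrite modnDdvd.
Qed.

Lemma expn_1D_n : (1 + d) ^ n = 1 %[mod n].
Proof. by rewrite expn_1D modnDdvd // dvdn_mulr. Qed.

Lemma coprime_1D : coprime n (1 + d).
Proof.
have: coprime n ((1 + d) ^ n) by rewrite -coprime_modr expn_1D_n coprime_modr coprimen1.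
by rewrite coprime_pexpr.
Qed.

End GeometricSum.

(** * Regular permutation groups normalised by the translations of a cyclic group *)

Section RegularSubgroups.

Local Open Scope group_scope.

(** By orbit-stabiliser, order [#|gT|] and a trivial stabiliser at one point give transitivity, and
    then trivial stabilisers everywhere. *)
Lemma regular_permP (gT : finGroupType) (G : {group {perm gT}}) (x0 : gT) :
  reflect (#|G| = #|gT| /\ (forall g : {perm gT}, g \in G -> g x0 = x0 -> g = 1))
          (regular_perm G).
Proof.
apply: (iffP andP) => [[trG /forallP stabG] | [oG freeG]].
  have free x : 'C_G[x | 'P] = 1 by apply/eqP/stabG.
  split=> [|g Gg gx]; last first.
    by apply/set1gP; rewrite -(free x0) inE Gg; apply/astab1P.
  have := card_orbit_stab 'P G x0; rewrite (atransP trG) ?inE // free.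
  by rewrite cards1 muln1 cardsT.
have stab0 : 'C_G[x0 | 'P] = 1.
  apply/trivgP/subsetP => g /setIP[Gg /astab1P gx].
  by apply/set1gP/freeG.
have orb0 : orbit 'P G x0 = [set: gT].
  apply/eqP; rewrite eqEcard subsetT cardsT -oG.
  by rewrite -(card_orbit_stab 'P G x0) stab0 cards1 muln1 /=.
have trG : [transitive G, on [set: gT] | 'P].
  by apply/imsetP; exists x0; rewrite ?inE ?orb0.
split=> //; apply/forallP => x; rewrite trivg_card1.
have := card_orbit_stab 'P G x; rewrite (atransP trG) ?inE // cardsT -oG.
by rewrite -{2}[#|G|]muln1 => /eqP; rewrite eqn_pmul2l ?cardG_gt0.
Qed.

Variables (gT : finGroupType) (gam : gT).
Hypothesis genT : [set: gT] = <[gam]>.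
Implicit Types (G : {group {perm gT}}) (h g : {perm gT}) (x y : gT).

Local Notation n := #|gT|.
Local Notation s := (lambda_perm gam).

Lemma expg_gam y : exists i, y = gam ^+ i.
Proof. by apply/cycleP; rewrite -genT inE. Qed.

Lemma order_gam : #[gam] = n.
Proof. by rewrite orderE -genT cardsT. Qed.

Lemma eq_expg_gam i j : (gam ^+ i == gam ^+ j) = (i == j %[mod n]).
Proof. by rewrite eq_expg_mod_order order_gam. Qed.

Lemma cyclic_mulgC : commutative (@mulg gT).
Proof.
move=> x y; have [i ->] := expg_gam x; have [j ->] := expg_gam y.
by rewrite -!expgD addnC.
Qed.

Lemma lambda_permX i y : (s ^+ i) y = gam ^+ i * y.
Proof.
elim: i => [|i IHi]; first by rewrite perm1 mul1g.
by rewrite expgSr permM IHi permE expgS mulgA.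
Qed.

Lemma order_lambda : #[s] = n.
Proof.
apply/eqP; rewrite -order_gam eqn_dvd !order_dvdn; apply/andP; split.
  by apply/eqP/permP => y; rewrite lambda_permX expg_order mul1g perm1.
by have := lambda_permX #[s] 1; rewrite expg_order perm1 mulg1 => <-.
Qed.

Lemma lambda_free i : (s ^+ i) 1 = 1 -> s ^+ i = 1.
Proof.
rewrite lambda_permX mulg1 => gi1.
by apply/permP => y; rewrite lambda_permX gi1 mul1g perm1.
Qed.

(** Every translation is a power of [s], so normalisation need only be tested on [s]. *)
Lemma HGSP G :
  reflect [/\ #|G| = n, forall g, g \in G -> g 1 = 1 -> g = 1 & s \in 'N(G)]
          (G \in HGS gT).
Proof.
have -> : (G \in HGS gT) = regular_perm G && (s \in 'N(G)).
  rewrite inE; congr (_ && _); apply/subsetP/idP => [|nGs h /imsetP[y _ ->]].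
    by apply; apply/imsetP; exists gam.
  have [i ->] := expg_gam y.
  have -> : lambda_perm (gam ^+ i) = s ^+ i.
    by apply/permP => x; rewrite lambda_permX permE.
  by rewrite groupX.
by apply: (iffP andP) => [[/(regular_permP _ 1)[]] | [oG fG nGs]]; split=> //;
  apply/(regular_permP _ 1).
Qed.

Lemma regular_trans G y :
  G \in HGS gT -> exists2 g, g \in G & g 1 = y.
Proof.
rewrite inE => /andP[/andP[trG _] _].

have: y \in orbit 'P G 1 by rewrite (atransP trG) inE.
by case/orbitP => g Gg <-; exists g.
Qed.

Lemma regular_inj G g h :
  G \in HGS gT -> g \in G -> h \in G -> g 1 = h 1 -> g = h.
Proof.
case/HGSP => _ freeG _ Gg Gh eq1; apply/eqP; rewrite eq_mulgV1; apply/eqP.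
by apply: freeG; rewrite ?groupM ?groupV // permM eq1 permK.
Qed.

(** * Affine maps of a cyclic group and the regular subgroups they generate *)

Section Affine.

Variable (d : nat).
Hypotheses (dvd_d2 : n %| d ^ 2) (rad_d : rad n %| d) (odd_or_0 : odd n \/ d = 0).

Let n_gt0 : (0 < n)%N. Proof. by rewrite -order_gam. Qed.

Lemma affine_inj : injective (fun y : gT => gam * y ^+ (1 + d)).
Proof.
have co : coprime #|[set: gT]| (1 + d) by rewrite cardsT coprime_1D.
by move=> x y /mulgI; apply: (can_in_inj (expgK co)); rewrite inE.
Qed.

(** In the additive coordinate [gam ^+ x], this is [x] to [(1 + d) * x + 1]. *)
Definition affine_perm : {perm gT} := perm affine_inj.
Local Notation h := affine_perm.

Lemma affine_permX m y :
  (h ^+ m) y = gam ^+ geom (1 + d) m * y ^+ ((1 + d) ^ m)%N.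
Proof.
elim: m => [|m IHm]; first by rewrite /geom big_ord0 perm1 mul1g.
rewrite expgSr permM IHm permE geomS expgMn; last exact: cyclic_mulgC.
rewrite -!expgM -expnSr mulgA -{1}[gam]expg1 -expgD; congr (gam ^+ _ * _).
by rewrite mulnC addnC.
Qed.

Lemma affine_permX1 m : ((h ^+ m) 1 == 1) = (n %| m).
Proof.
rewrite affine_permX expg1n mulg1 -order_dvdn order_gam.
by rewrite dvdn_geom_1D.
Qed.

Lemma cycle_expg_mod y i j : i = j %[mod n] -> y ^+ i = y ^+ j.
Proof.
by move=> eq_ij; rewrite -(expg_mod i (expg_cardG (in_setT y))) cardsT eq_ij
  -cardsT expg_mod // expg_cardG ?inE.
Qed.

Lemma order_affine : #[h] = n.
Proof.
apply/eqP; rewrite eqn_dvd; apply/andP; split; last first.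
  by rewrite -affine_permX1 expg_order perm1.
rewrite order_dvdn; apply/eqP/permP => y; rewrite affine_permX perm1.
rewrite (cycle_expg_mod y (expn_1D_n dvd_d2)) expg1.
by have := affine_permX1 n; rewrite affine_permX expg1n mulg1 dvdnn => /eqP->;
  rewrite mul1g.
Qed.

(** Both sides send [y] to [gam ^+ (1 + d) * y ^+ (1 + d)]. *)
Lemma affine_conj : h ^ s^-1 = h ^+ (1 + d).
Proof.
apply/permP => y; rewrite conjgE invgK mulgA !permM.
apply: (@perm_inj _ s); rewrite permKV affine_permX !permE /=.
rewrite (cycle_expg_mod gam (geom_1D_self dvd_d2 odd_or_0)).
rewrite (cycle_expg_mod y (expn_1D_self dvd_d2)).
by rewrite expgMn //; exact: cyclic_mulgC.
Qed.

Lemma affine_HGS : <[h]>%G \in HGS gT.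
Proof.
apply/HGSP; split; first exact: order_affine.
  move=> _ /cycleP[i ->] /eqP; rewrite affine_permX1 => dvd_i.
  by apply/eqP; rewrite -order_dvdn order_affine.
rewrite -groupV; apply/normP/eqP; rewrite eqEcard cardJg leqnn andbT.
by rewrite -cycleJ affine_conj cycleX.
Qed.

End Affine.

Lemma affine_perm1 d (d2 : n %| d ^ 2) : affine_perm d2 1 = gam.
Proof. by rewrite permE expg1n mulg1. Qed.

(** * Counting: affine maps for the lower bound, the multiplier [k] for the upper bound *)

Hypotheses (dvd_rad2 : n %| rad n ^ 2) (odd_or_rad : odd n \/ rad n = n).

Let n_gt0 : (0 < n)%N. Proof. by rewrite -order_gam. Qed.

Lemma leq_card_HGS : (n %/ rad n <= #|HGS gT|)%N.
Proof.
have r_gt0 : (0 < rad n)%N := dvdn_gt0 n_gt0 (rad_dvdn n).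
have d2 (c : 'I_(n %/ rad n)) : n %| (c * rad n) ^ 2.
  by rewrite expnMn dvdn_mull.
have lt_n (c : 'I_(n %/ rad n)) : (c * rad n < n)%N.
  by rewrite -[X in (_ < X)%N](divnK (rad_dvdn n)) ltn_pmul2r ?ltn_ord.
have odd_or_0 (c : 'I_(n %/ rad n)) : odd n \/ (c * rad n = 0)%N.
  case: odd_or_rad => [|rn]; [by left | right].
  case: c => c /=; rewrite rn divnn n_gt0 ltnS leqn0 => /eqP->.
  exact: mul0n.
pose F c := <[affine_perm (d2 c)]>%G.
have F_HGS c : F c \in HGS gT.
  by apply: affine_HGS; [exact: dvdn_mull | exact: odd_or_0].
(* A regular subgroup has only one element sending 1 to [gam], so equal subgroups give equal affine
   maps; their values at [gam] determine [c]. *)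
have F_inj : injective F.
  move=> c c' eqF; apply: val_inj => /=.
  have Gc : affine_perm (d2 c) \in F c by exact: cycle_id.
  have Gc' : affine_perm (d2 c') \in F c by rewrite eqF cycle_id.
  have := regular_inj (F_HGS c) Gc Gc'; rewrite !affine_perm1 => /(_ erefl).
  move/(congr1 (fun h : {perm gT} => h gam)); rewrite !permE => /mulgI/eqP.
  rewrite eq_expg_gam eqn_modDl !modn_small //.
  by rewrite eqn_pmul2r // => /eqP.
rewrite -[X in (X <= _)%N]card_ord -(card_imset _ F_inj) subset_leq_card //.
by apply/subsetP => _ /imsetP[c _ ->].
Qed.

(* [s] multiplies the [h]-logarithm of a point by [k] and adds 1. *)
Lemma lambda_logarithm h k j :
  h 1 = gam -> h ^ s = h ^+ k -> (s ^+ j) 1 = (h ^+ geom k j) 1.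
Proof.
move=> h1 hs; elim: j => [|j IHj]; first by rewrite /geom big_ord0 !perm1.
rewrite expgSr permM IHj geomS addn1 expgS [in RHS]permM h1 -permM.
by rewrite conjgC conjXg hs permM permE mulg1 -expgM.
Qed.

(** Take [h] in [G] agreeing with [s] at 1. Subgroups of a cyclic group are characteristic, so [s]
    normalises [<[h]>]; the [s]-orbit of 1, which is everything, then lies in its [<[h]>]-orbit. *)
Lemma HGS_generator G :
    cyclic G -> G \in HGS gT ->
  exists h, exists k, [/\ <[h]> = G, h 1 = gam, h ^ s = h ^+ k & (0 < k)%N].
Proof.
move=> cycG HG; have [oG _ nGs] := HGSP _ HG.
have [h Gh h1] := regular_trans gam HG.
have /cycleP[k hs] : h ^ s \in <[h]>.
  have: s \in 'N(<[h]>).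
    rewrite -sub1set (char_norm_trans _ (_ : _ \subset 'N(G))) ?sub1set //.
    by rewrite sub_cyclic_char // cycle_subG.
  by move=> nhs; rewrite memJ_norm ?cycle_id.
(* Adding the order of [h] makes the exponent positive, so that [k - 1] is not truncated later. *)
exists h; exists (k + #[h]); rewrite addn_gt0 order_gt0 orbT.
rewrite expgD expg_order mulg1; split=> //.
apply/eqP; rewrite eqEsubset cycle_subG Gh; apply/subsetP => g Gg.
have [j gj] := expg_gam (g 1).
have := lambda_logarithm j h1 hs; rewrite lambda_permX mulg1 -gj => g1.
by rewrite (regular_inj HG Gg (groupX _ Gh) g1) mem_cycle.
Qed.

Lemma geom_mod_surj h k i :
    <[h]>%G \in HGS gT -> h 1 = gam -> h ^ s = h ^+ k ->
  exists2 j, (h ^+ i) 1 = gam ^+ j & geom k j = i %[mod n].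
Proof.
move=> HG h1 hs; have [j hj] := expg_gam ((h ^+ i) 1); exists j => //.
have := lambda_logarithm j h1 hs; rewrite lambda_permX mulg1 -hj => eq1.
have [oh _ _] := HGSP _ HG.
have /eqP := regular_inj HG (mem_cycle h i) (mem_cycle h _) eq1.
by rewrite eq_expg_mod_order orderE oh => /eqP.
Qed.

(** Conjugates have equal order, so [k] is prime to [n]; the sums [geom k j] reach every residue
    modulo each prime [p] dividing [n], so [p] divides [k - 1]. *)
Lemma HGS_exponent h k :
    <[h]>%G \in HGS gT -> h 1 = gam -> h ^ s = h ^+ k -> (0 < k)%N ->
  exists c : 'I_(n %/ rad n), h ^ s = h ^+ (1 + c * rad n).
Proof.
move=> HG h1 hs k_gt0; have [oh _ _] := HGSP _ HG; rewrite -orderE in oh.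
have r_gt0 : (0 < rad n)%N := dvdn_gt0 n_gt0 (rad_dvdn n).
have co_k : coprime n k.
  have := orderXgcd h k; rewrite -hs orderJ oh => /eqP.
  have dvd_g := dvdn_gcdl n k.
  have g_gt0 : (0 < gcdn n k)%N by rewrite gcdn_gt0 n_gt0.
  rewrite eqn_div // -[X in _ == X -> _]muln1 eqn_pmul2l //.
have /dvdnP[e ke] : rad n %| k - 1.
  apply: rad_dvd => p p_n; have := p_n; rewrite mem_primes => /and3P[p_pr _ dvd_p].
  apply: geom_surj_dvd => // [|i].
    by rewrite -prime_coprime // (coprime_dvdl dvd_p).
  have [j _ eq_j] := geom_mod_surj i HG h1 hs.
  by exists j; rewrite -(modn_dvdm _ dvd_p) eq_j modn_dvdm.
have lt_c : (e %% (n %/ rad n) < n %/ rad n)%N.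
  by rewrite ltn_mod divn_gt0 // dvdn_leq ?rad_dvdn.
exists (Ordinal lt_c); rewrite hs /=; apply/eqP.
rewrite eq_expg_mod_order oh -[k in X in (X == _ %[mod _])](subnKC k_gt0) ke.
by rewrite eqn_modDl muln_modl divnK ?rad_dvdn // modn_mod.
Qed.

(** The logarithm of [gam ^+ j] is [geom k j] for both generators, so [h ^+ i] and [h' ^+ i] agree
    at 1 for all [i], hence [h] and [h'] agree everywhere. *)
Lemma HGS_unique h h' k :
    <[h]>%G \in HGS gT -> <[h']>%G \in HGS gT ->
    h 1 = gam -> h' 1 = gam -> h ^ s = h ^+ k -> h' ^ s = h' ^+ k ->
  h = h'.
Proof.
move=> HG HG' h1 h1' hs hs'.
have [oh' _ _] := HGSP _ HG'; rewrite -orderE in oh'.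
have eqX i : (h ^+ i) 1 = (h' ^+ i) 1.
  have [j -> eq_j] := geom_mod_surj i HG h1 hs.
  rewrite -[LHS]mulg1 -lambda_permX (lambda_logarithm j h1' hs').
  by congr (fun_of_perm _ 1); apply/eqP; rewrite eq_expg_mod_order oh' eq_j.
apply/permP => y; have [_ /cycleP[i ->] <-] := regular_trans y HG.
by rewrite -permM -expgSr eqX expgSr permM -eqX.
Qed.

Hypothesis HGS_cyclic : forall G, G \in HGS gT -> cyclic G.

Lemma card_HGS_leq : (#|HGS gT| <= n %/ rad n)%N.
Proof.
(* [E] need only cover [HGS gT], so the trivial group is a harmless default for a residue that no
   subgroup realises. *)
pose E (c : 'I_(n %/ rad n)) : {group {perm gT}} := odflt 1%G
  [pick G in HGS gT |
    [exists h, [&& <[h]>%G == G, h 1 == gam & h ^ s == h ^+ (1 + c * rad n)]]].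
rewrite -[X in (_ <= X)%N]card_ord (leq_trans _ (leq_imset_card E _)) //.
apply/subset_leq_card/subsetP => G HG.
have [h [k [defG h1 hs k_gt0]]] := HGS_generator (HGS_cyclic HG) HG.
have defG' : <[h]>%G = G by apply: val_inj.
rewrite -defG' in HG *; have [c hc] := HGS_exponent HG h1 hs k_gt0.
apply/imsetP; exists c => //; rewrite /E; case: pickP => [G' /=|/(_ <[h]>%G)].
  case/andP=> HG' /existsP[h' /and3P[/eqP defG2 /eqP h1' /eqP hs']].
  by rewrite -defG2 in HG' *; rewrite (HGS_unique HG HG' h1 h1' hc hs').
rewrite HG /= => /negbT/existsPn/(_ h).
by rewrite eqxx h1 hc !eqxx.
Qed.

End RegularSubgroups.

(** * Cyclicity and the exact count combined *)

Theorem theorem4 (gT : finGroupType) (n : nat) :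
  0 < n ->
  (forall p, p \in primes n -> logn p n <= 2) ->
  (forall p q, p \in primes n -> q \in primes n -> ~~ (p %| q ^ logn q n - 1)) ->
  ~~ (4 %| n) ->
  cyclic [set: gT] -> #|gT| = n ->
  #|HGS gT| = n %/ rad n /\ (forall G : {group {perm gT}}, G \in HGS gT -> cyclic G).
Proof.
move=> n_gt0 le2 ndvd n4 /cyclicP[gam genT] oT.
have HGScyc (G : {group {perm gT}}) : G \in HGS gT -> cyclic G.
  move=> HG; have [oG freeG nGs] := HGSP genT _ HG.
  apply: (cyclic_of_cyclic_semireg_norm le2 ndvd n4 _ _ nGs _ freeG).
  - by rewrite oG.
  - by rewrite (order_lambda genT).
  - by move=> y; apply: regular_trans.
  - by move=> i; apply: lambda_free.
split=> //; rewrite -oT in n_gt0 le2 ndvd n4 *.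
have dvd2 := dvdn_rad_sqr n_gt0 le2.
have odd_or := odd_or_eq_rad n_gt0 n4 ndvd.
apply/eqP; rewrite eqn_leq (card_HGS_leq genT) //.
exact: (leq_card_HGS genT).
Qed.
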